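(* Let $N\ge1$ and consider gradient descent with stepsizes $h=(h_0,\dots,h_{N-1})$, $h_k>0$ for all $k$. For any $L,D>0$, if $$\max_{(x_0,f)\in\mathfrak F_{L,D}} f(x_N)-\inf f=\frac{LD^2}{4\sum_{i=0}^{N-1}h_i+2},$$ then $$\min_{\sigma\in\Delta_{N+1}}\ \max_{(x_0,f)\in\mathfrak F_{L,D}} f\Big(\sum_{j=0}^N\sigma_jx_j\Big)-\inf f=\frac{LD^2}{4\sum_{i=0}^{N-1}h_i+2},$$ with $\sigma=(0,\dots,0,1)$ as the unique minimizer over $\Delta_{N+1}$.
   Context: Fix a dimension $d\ge1$ with the Euclidean norm on $\mathbb R^d$. A differentiable function is $L$-smooth if its gradient is $L$-Lipschitz. $\mathfrak F_{L,D}$ is the set of pairs $(x_0,f)$ with $f:\mathbb R^d\to\mathbb R$ convex and $L$-smooth, having a minimizer $x_\star$ with $\|x_0-x_\star\|\le D$. Given $(x_0,f)$ and stepsizes $h$, gradient descent produces $x_{k+1}=x_k-\frac{h_k}{L}\nabla f(x_k)$, $k=0,\dots,N-1$. $\Delta_{N+1}=\{\sigma=(\sigma_0,\dots,\sigma_N)\in\mathbb R^{N+1}:\sigma\ge0,\ \sum_j\sigma_j=1\}$. ''Max'' over $\mathfrak F_{L,D}$ means worst-case value (supremum). *)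

(* Defs.v *)
From HB Require Import structures.
From mathcomp Require Import all_boot all_order all_algebra.
From mathcomp Require Import all_classical all_reals all_analysis.

Set Implicit Arguments.
Unset Strict Implicit.
Unset Printing Implicit Defensive.

Import Order.TTheory GRing.Theory Num.Theory.
Import numFieldNormedType.Exports.

Local Open Scope classical_set_scope.
Local Open Scope ring_scope.

(* The norm `|x| that MathComp-Analysis puts on 'rV[R]_d is the sup norm, hence
   a separate Euclidean norm.  Differentiability is unaffected by the choice,
   as all norms on R^d are equivalent. *)
Definition enorm (R : realType) (d : nat) (x : 'rV[R]_d) : R :=
  Num.sqrt (\sum_(i < d) x 0 i ^+ 2).

Definition gradient (R : realType) (d : nat) (f : 'rV[R]_d -> R)
    (x : 'rV[R]_d) : 'rV[R]_d :=
  \row_(i < d) 'D_(delta_mx 0 i) f x.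

Definition smooth (R : realType) (d : nat) (L : R) (f : 'rV[R]_d -> R) : Prop :=
  (forall x, differentiable f x) /\
  (forall x y, enorm (gradient f x - gradient f y) <= L * enorm (x - y)).

Definition problem_class (R : realType) (d : nat) (L D : R) :
    set ('rV[R]_d * ('rV[R]_d -> R)) :=
  [set p | [/\ convex_function setT p.2,
               smooth L p.2 &
               exists xstar, (forall y, p.2 xstar <= p.2 y) /\
                             enorm (p.1 - xstar) <= D]].

(* Stepsizes are h`_0, ..., h`_(N-1); iterates of index k > size h are junk
   (the step past the end of h is 0) and never used. *)
Fixpoint gd (R : realType) (d : nat) (L : R) (h : seq R)
    (x0 : 'rV[R]_d) (f : 'rV[R]_d -> R) (k : nat) : 'rV[R]_d :=
  if k is k'.+1 then
    let x := gd L h x0 f k' in x - (h`_k' / L) *: gradient f x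
  else x0.

(* Worst-case suboptimality of the point [out x0 f] returned by a method;
   real [inf] is the true infimum here, since every f in the class has a
   minimizer. *)
Definition worst_case (R : realType) (d : nat) (L D : R)
    (out : 'rV[R]_d -> ('rV[R]_d -> R) -> 'rV[R]_d) : \bar R :=
  ereal_sup [set (p.2 (out p.1 p.2) - inf (range p.2))%:E
            | p in problem_class L D].

Definition simplex (R : realType) (n : nat) : set 'rV[R]_n :=
  [set s | (forall j, 0 <= s 0 j) /\ \sum_(j < n) s 0 j = 1].

Definition gd_last (R : realType) (d N : nat) (L : R) (h : N.-tuple R)
    (x0 : 'rV[R]_d) (f : 'rV[R]_d -> R) : 'rV[R]_d :=
  gd L h x0 f N.

Definition gd_average (R : realType) (d N : nat) (L : R) (h : N.-tuple R)
    (s : 'rV[R]_N.+1) (x0 : 'rV[R]_d) (f : 'rV[R]_d -> R) : 'rV[R]_d :=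
  \sum_(j < N.+1) s 0 j *: gd L h x0 f j.

Definition minimizers (R : realType) (T : Type) (A : set T) (phi : T -> \bar R) :
    set T :=
  [set s | A s /\ forall t, A t -> (phi s <= phi t)%E].

(* Main.v *)
(* Take a Huber function f of one coordinate, with threshold
   tau = D / (2 S + 1) where S is the sum of all the stepsizes, and start at
   D e_1.  All the iterates stay in the affine region of f, at
   x_j = (D - tau H_j) e_1 with H_j the sum of the first j stepsizes.  Since f
   is affine there and f x_N is exactly the rate, f at the average with weights
   sigma exceeds the rate by L tau^2 sum_j sigma_j (S - H_j).  This gap is
   nonnegative, and it is zero only if sigma is concentrated on j = N. *)
Require Import Defs.
From HB Require Import structures.
From mathcomp Require Import all_boot all_order all_algebra.
From mathcomp Require Import all_classical all_reals all_analysis.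
From mathcomp Require Import ring lra.

Set Implicit Arguments.
Unset Strict Implicit.
Unset Printing Implicit Defensive.

Import Order.TTheory GRing.Theory Num.Theory.
Import numFieldNormedType.Exports.

Local Open Scope classical_set_scope.
Local Open Scope ring_scope.

(** * Derivatives from quadratic error bounds; the Huber function on the line *)

(** The difference quotient is within [K * |t|] of [c]. Derivatives can thus be read off
    [huber_tangent], without differentiating a maximum. *)
Lemma is_derive_quadratic (R : realType) (V : normedModType R) (f : V -> R)
    (x v : V) (c K : R) :
  (forall t, `|f (t *: v + x) - f x - t * c| <= K * t ^+ 2) ->
  is_derive x v f c.
Proof.
move=> fK.
suff cvc : h^-1 *: ((f \o shift x) (h *: v) - f x) @[h --> 0^'] --> c.
  by apply: DeriveDef; [apply/cvg_ex; exists c | exact: cvg_lim].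
(* The added 1 keeps the divisor in the choice of [t] positive. *)
have K1 : 0 < `|K| + 1 by rewrite ltr_wpDl.
apply/cvgrPdist_le => e e0; near=> t.
have t0 : t != 0 by near: t; exact: nbhs_dnbhs_neq.
have tn0 : 0 < `|t| by rewrite normr_gt0.
have te : `|t| <= e / (`|K| + 1).
  by near: t; apply: dnbhs0_le; rewrite divr_gt0.
rewrite distrC /= -(ler_pM2l tn0) -normrM.
have -> : t * (t^-1 * (f (t *: v + x) - f x) - c)
        = f (t *: v + x) - f x - t * c by field.
apply: le_trans (fK t) _; rewrite -[t ^+ 2]ger0_norm ?sqr_ge0// normrX.
rewrite expr2 mulrCA ler_pM2l//.
move: te; rewrite ler_pdivlMr// => te.
apply: le_trans te; rewrite mulrC ler_pM2l//.
by rewrite (le_trans (ler_norm K))// lerDl.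
Unshelve. all: by end_near.
Qed.

(* One-sided: quadratic on all of ]-oo, tau], affine only beyond tau. *)
Definition huber (R : realType) (L tau t : R) : R :=
  L * (t ^+ 2 - Num.max (t - tau) 0 ^+ 2) / 2.

(** [L * Num.min t tau] is the slope at [t]. The lower bound carries convexity, the upper one
    smoothness; together they give the derivative. *)
Lemma huber_tangent (R : realType) (L tau t u : R) : 0 <= L ->
  0 <= huber L tau u - huber L tau t - (u - t) * (L * Num.min t tau)
    <= L / 2 * (u - t) ^+ 2.
Proof.
move=> L0; rewrite /huber.
have -> : L * (u ^+ 2 - Num.max (u - tau) 0 ^+ 2) / 2
  - L * (t ^+ 2 - Num.max (t - tau) 0 ^+ 2) / 2
  - (u - t) * (L * Num.min t tau) = L / 2 * ((u ^+ 2 - Num.max (u - tau) 0 ^+ 2)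
  - (t ^+ 2 - Num.max (t - tau) 0 ^+ 2) - 2 * (u - t) * Num.min t tau) by field.
have L2 : 0 <= L / 2 by lra.
have maxE (s : R) : Num.max (s - tau) 0 = if s <= tau then 0 else s - tau.
  by rewrite maxEle subr_le0.
rewrite !maxE minEle.
(* Without the factor L/2, the tangent gap is in turn (u-t)^2, (tau-t)(2u-t-tau), (u-tau)^2 and 0.
   It falls short of (u-t)^2 by 0, (u-tau)^2, (t-tau)(t+tau-2u) and (u-t)^2. *)
have [tt|/ltW tt] := leP t tau; have [ut|/ltW ut] := leP u tau.
all: apply/andP; split; [apply: mulr_ge0 => //|apply: ler_wpM2l => //].
- by have := sqr_ge0 (u - t); lra.
- lra.
- have : 0 <= (tau - t) * (2 * u - t - tau) by apply: mulr_ge0; lra.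
  lra.
- by have := sqr_ge0 (u - tau); lra.
- by have := sqr_ge0 (u - tau); lra.
- have : 0 <= (t - tau) * (t + tau - 2 * u) by apply: mulr_ge0; lra.
  lra.
- lra.
- by have := sqr_ge0 (u - t); lra.
Qed.

Lemma huber_linear (R : realType) (L tau t : R) : tau <= t ->
  huber L tau t = L * tau * (t - tau / 2).
Proof.
by move=> h; rewrite /huber (max_idPl (_ : 0 <= _)) ?subr_ge0//; field.
Qed.

Lemma huber0 (R : realType) (L tau : R) : 0 <= tau -> huber L tau 0 = 0.
Proof. by move=> h; rewrite /huber (max_idPr (_ : _ <= 0)); [ring|lra]. Qed.

(** * The Huber function of one coordinate, and gradient descent on it *)

Section coordinate_huber.
Variables (R : realType) (d : nat) (L tau : R) (i : 'I_d).
Hypotheses (L0 : 0 <= L) (tau0 : 0 <= tau).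

Definition coord_huber (x : 'rV[R]_d) : R := huber L tau (x 0 i).

Lemma huber_ge0 t : 0 <= huber L tau t.
Proof.
have /andP[+ _] := huber_tangent tau 0 t L0.
by rewrite huber0// (min_idPl tau0) !mulr0 !subr0.
Qed.

Lemma coord_huber_tangent (x y : 'rV[R]_d) :
  coord_huber x + (y 0 i - x 0 i) * (L * Num.min (x 0 i) tau) <= coord_huber y.
Proof.
have /andP[+ _] := huber_tangent tau (x 0 i) (y 0 i) L0.
by rewrite /coord_huber; lra.
Qed.

Lemma convex_coord_huber : convex_function setT coord_huber.
Proof.
move=> t x y _ _; rewrite convRE.
set z := conv t x y; set s := t%:num.
have zE : z 0 i = s * x 0 i + (1 - s) * y 0 i by rewrite !mxE.
have s0 : 0 <= s by rewrite /s ge0.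
have s1 : 0 <= 1 - s by rewrite subr_ge0 /s le1.
(* In the weighted sum of the two tangent inequalities at [z], the slope terms cancel. *)
have := ler_wpM2l s0 (coord_huber_tangent z x).
have := ler_wpM2l s1 (coord_huber_tangent z y).
rewrite zE; set m := L * _ => hy hx.
change (coord_huber z <= s * coord_huber x + (1 - s) * coord_huber y).
by lra.
Qed.

Lemma is_derive_coord_huber (x v : 'rV[R]_d) :
  is_derive x v coord_huber (v 0 i * (L * Num.min (x 0 i) tau)).
Proof.
apply: (@is_derive_quadratic _ _ _ _ _ _ (L / 2 * v 0 i ^+ 2)) => t.
rewrite /coord_huber !mxE [t * (_ * (L * _))]mulrA.
have := huber_tangent tau (x 0 i) (t * v 0 i + x 0 i) L0.
rewrite addrK => /andP[h1 h2]; rewrite ger0_norm//.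
by apply: (le_trans h2); rewrite exprMn mulrA mulrAC.
Qed.

(** Directional derivatives alone do not give differentiability, so the function is split into a
    coordinate map and a function of one real variable, for which derivability suffices. *)
Lemma differentiable_coord_huber (x : 'rV[R]_d) : differentiable coord_huber x.
Proof.
apply: differentiable_comp => //.
  by apply: differentiable_coord.
apply/derivable1_diffP; apply: ex_derive.
apply: (@is_derive_quadratic _ R^o _ _ _
  (L * Num.min (x 0 i) tau) (L / 2)) => t.
have := huber_tangent tau (x 0 i) (t + x 0 i) L0; rewrite addrK => /andP[h1 h2].
by rewrite /= [t *: 1]mulr1 ger0_norm.
Qed.

Lemma gradient_coord_huber (x : 'rV[R]_d) :
  gradient coord_huber x = (L * Num.min (x 0 i) tau) *: delta_mx 0 i.
Proof.
apply/rowP => j; rewrite !mxE.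
rewrite (derive_val (is_derive := is_derive_coord_huber x (delta_mx 0 j))).
by rewrite mxE eqxx/= mulrC eq_sym.
Qed.

Lemma enormZ_delta (c : R) : enorm (c *: delta_mx 0 i : 'rV[R]_d) = `|c|.
Proof.
rewrite /enorm (bigD1 i)//= big1 ?addr0 => [|j ji].
  by rewrite !mxE !eqxx mulr1 sqrtr_sqr.
by rewrite !mxE (negbTE ji) mulr0 expr0n.
Qed.

Lemma norm_coord_le_enorm (x : 'rV[R]_d) : `|x 0 i| <= enorm x.
Proof.
rewrite -sqrtr_sqr /enorm ler_sqrt; last first.
  by rewrite sumr_ge0// => j _; exact: sqr_ge0.
by rewrite (bigD1 i)//= lerDl sumr_ge0// => j _; exact: sqr_ge0.
Qed.

Lemma smooth_coord_huber : smooth L coord_huber.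
Proof.
split=> [|x y]; first exact: differentiable_coord_huber.
(* All gradients are parallel to one basis vector, so it remains that [Num.min _ tau] is
   1-Lipschitz. *)
rewrite !gradient_coord_huber -scalerBl enormZ_delta -mulrBr normrM ger0_norm//.
apply: ler_wpM2l => //; apply: le_trans (norm_coord_le_enorm _); rewrite !mxE.
move: (x 0 i) (y 0 i) => a b.
have := ler_norm (a - b); have := ler_norm (b - a); rewrite distrC => ba ab.
by have [] := leP a tau; have [] := leP b tau => ? ?;
  rewrite ler_norml; apply/andP; split; lra.
Qed.

Lemma problem_class_coord_huber (D : R) : 0 <= D ->
  problem_class L D (D *: delta_mx 0 i, coord_huber).
Proof.
move=> D0; split => /=; [exact: convex_coord_huber|exact: smooth_coord_huber|].
exists 0; split => [y|]; last by rewrite subr0 enormZ_delta ger0_norm.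
by rewrite /coord_huber mxE huber0// huber_ge0.
Qed.

Lemma inf_coord_huber : inf (range coord_huber) = 0.
Proof.
have lb : lbound (range coord_huber) 0 by move=> _ [x _ <-]; exact: huber_ge0.
apply/eqP; rewrite eq_le lb_le_inf ?andbT//; last first.
  by exists (coord_huber 0); exists 0.
apply: ge_inf; first by exists 0.
by exists 0 => //; rewrite /coord_huber mxE huber0.
Qed.

(** In the affine region the gradient has constant length [L * tau], so step l moves by [tau] times
    its stepsize. Only the iterates before the k-th must lie there. *)
Lemma gd_coord_huber (h : seq R) (D : R) k :
  L != 0 ->
  (forall j, (j < k)%N -> tau <= D - tau * \sum_(l < j) h`_l) ->
  gd L h (D *: delta_mx 0 i) coord_huber k
    = (D - tau * \sum_(l < k) h`_l) *: delta_mx 0 i.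
Proof.
move=> Ln0; elim: k => [|k IH] hk; first by rewrite big_ord0 mulr0 subr0.
rewrite /= IH; last by move=> j jk; apply: hk; rewrite ltnS ltnW.
rewrite gradient_coord_huber !mxE !eqxx mulr1 (min_idPr (hk k _))//.
rewrite scalerA -scalerBl big_ord_recr/=; congr (_ *: _).
by field.
Qed.

End coordinate_huber.

(** * Lower bound on the worst case of an average of the iterates *)

Section average_lower_bound.
Variables (R : realType) (d N : nat) (h : N.-tuple R) (L D : R).
Hypotheses (hd : (0 < d)%N) (hpos : forall k : 'I_N, 0 < tnth h k).
Hypotheses (hL : 0 < L) (hD : 0 < D).

Let stepsum (k : nat) : R := \sum_(l < k) h`_l.
Let S := stepsum N.
Let tau := D / (2 * S + 1).

(** The k-th stepsize is positive and counted only on the right. This strictness yields uniqueness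
    of the minimizer. *)
Lemma stepsum_lt k : (k < N)%N -> stepsum k < S.
Proof.
move=> kN; have nth_gt0 l : (l < N)%N -> 0 < h`_l.
  by move=> lN; rewrite -(tnth_nth 0 h (Ordinal lN)).
rewrite /S /stepsum -(big_mkord xpredT (nth 0 h)) -(big_mkord xpredT (nth 0 h)).
rewrite (big_cat_nat (n := k) _ (ltnW kN))//= ltrDl big_ltn//.
rewrite ltr_pwDl ?nth_gt0//.
by rewrite big_nat_cond sumr_ge0// => l /andP[/andP[_ /nth_gt0/ltW]].
Qed.

Lemma stepsum_le k : (k <= N)%N -> stepsum k <= S.
Proof. by rewrite leq_eqVlt => /predU1P[->//|/stepsum_lt/ltW]. Qed.

Lemma stepsum_ge0 : 0 <= S.
Proof. by have := stepsum_le (leq0n N); rewrite /stepsum big_ord0. Qed.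

Lemma worst_case_average_ge (s : 'rV[R]_N.+1) : simplex s ->
  ((L * D ^+ 2 / (4 * S + 2)
    + L * tau ^+ 2 * \sum_(j < N.+1) s 0 j * (S - stepsum j))%:E
     <= worst_case L D (@gd_average R d N L h s))%E.
Proof.
move=> [s0 s1]; have S0 := stepsum_ge0.
have S1 : 0 < 2 * S + 1 by lra.
have tau0 : 0 < tau by rewrite divr_gt0.
have DE : D = tau * (2 * S + 1) by rewrite divfK// gt_eqF.
pose i : 'I_d := Ordinal hd.
have tau_le k : (k <= N)%N -> tau <= D - tau * stepsum k.
  (* The right-hand side is tau (2S + 1 - stepsum k), whose factor is at least 1. *)
  move=> /stepsum_le kS; rewrite [X in X - _]DE -mulrBr.
  by rewrite ler_peMr//; [exact: ltW | lra].
apply: ereal_sup_ubound.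
exists (D *: delta_mx 0 i, coord_huber L tau i).
  by apply: problem_class_coord_huber; exact: ltW.
congr EFin; rewrite /= inf_coord_huber ?ltW// subr0.
have -> : gd_average L h s (D *: delta_mx 0 i) (coord_huber L tau i)
    = (\sum_(j < N.+1) s 0 j * (D - tau * stepsum j)) *: delta_mx 0 i.
  rewrite /gd_average scaler_suml; apply: eq_bigr => j _.
  rewrite gd_coord_huber ?gt_eqF ?ltW// ?scalerA//.
  by move=> k kj; apply: tau_le; rewrite -ltnS (ltn_trans kj).
(* An average of points at or beyond [tau] is again there, so the affine formula applies. *)
rewrite /coord_huber !mxE !eqxx mulr1 huber_linear; last first.
  rewrite -[leLHS]mul1r -s1 mulr_suml; apply: ler_sum => j _.
  by apply: ler_wpM2l => //; apply: tau_le; rewrite -ltnS.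
have -> : \sum_(j < N.+1) s 0 j * (D - tau * stepsum j)
    = D - tau * S + tau * \sum_(j < N.+1) s 0 j * (S - stepsum j).
  transitivity (\sum_(j < N.+1)
      (s 0 j * (D - tau * S) + tau * (s 0 j * (S - stepsum j)))).
    by apply: eq_bigr => j _; ring.
  by rewrite big_split/= -mulr_suml -mulr_sumr s1 mul1r.
(* At D - tau S = tau (S + 1) the affine formula gives L tau^2 (2S + 1) / 2, which is the rate. *)
rewrite {1 2}DE; field.
by rewrite gt_eqF//; lra.
Qed.

Lemma average_gap_ge0 (s : 'rV[R]_N.+1) : simplex s ->
  0 <= \sum_(j < N.+1) s 0 j * (S - stepsum j).
Proof.
move=> [s0 _]; apply: sumr_ge0 => j _.
by rewrite mulr_ge0// subr_ge0 stepsum_le// -ltnS.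
Qed.

Lemma average_gap_eq0 (s : 'rV[R]_N.+1) : simplex s ->
  \sum_(j < N.+1) s 0 j * (S - stepsum j) = 0 -> s = delta_mx 0 ord_max.
Proof.
move=> [s0 s1] /eqP; rewrite psumr_eq0; last first.
  by move=> j _; rewrite mulr_ge0// subr_ge0 stepsum_le// -ltnS.
move=> /allP gap0.
have sj0 j : j != ord_max -> s 0 j = 0.
  move=> jN; have := gap0 j (mem_index_enum _).
  rewrite /= mulf_eq0 subr_eq0 => /orP[/eqP//|].
  by rewrite gt_eqF// stepsum_lt// ltn_neqAle -ltnS ltn_ord andbT.
apply/rowP => j; rewrite mxE eqxx/=; case: eqP => [->|/eqP/sj0//].
by move: s1; rewrite (bigD1 ord_max)//= big1 ?addr0.
Qed.

End average_lower_bound.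

(** * The optimal value and its unique minimizer *)

Lemma gd_average_delta (R : realType) (d N : nat) (L : R) (h : N.-tuple R) :
  @gd_average R d N L h (delta_mx 0 ord_max) = gd_last L h.
Proof.
apply/funext => x0; apply/funext => f.
rewrite /gd_average (bigD1 ord_max)//= big1 => [|j jN].
  by rewrite mxE !eqxx scale1r addr0.
by rewrite mxE (negbTE jN) andbF scale0r.
Qed.

Lemma simplex_delta (R : realType) (n : nat) (i : 'I_n) :
  simplex (delta_mx 0 i : 'rV[R]_n).
Proof.
split=> [j|]; first by rewrite mxE ler0n.
rewrite (bigD1 i)//= big1 => [|j ji]; first by rewrite mxE !eqxx addr0.
by rewrite mxE (negbTE ji) andbF.
Qed.

Theorem theorem3p1 (R : realType) (d N : nat) (hd : (0 < d)%N) (hN : (0 < N)%N)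
    (h : N.-tuple R) (hpos : forall k : 'I_N, 0 < tnth h k)
    (L D : R) (hL : 0 < L) (hD : 0 < D) :
  let rate : R := L * D ^+ 2 / (4 * (\sum_(i < N) tnth h i) + 2) in
  let phi (s : 'rV[R]_N.+1) : \bar R :=
    worst_case L D (@gd_average R d N L h s) in
  worst_case L D (@gd_last R d N L h) = rate%:E ->
  ereal_inf [set phi s | s in @simplex R N.+1] = rate%:E /\
  minimizers (@simplex R N.+1) phi = [set delta_mx 0 ord_max].
Proof.
move=> rate phi phiN; pose e : 'rV[R]_N.+1 := delta_mx 0 ord_max.
(* The assumed rate of the last iterate enters only here. *)
have phie : phi e = rate%:E by rewrite /phi gd_average_delta.
have eS : simplex e by exact: simplex_delta.
have sumE : \sum_(i < N) tnth h i = \sum_(i < N) h`_i.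
  by apply: eq_bigr => i _; rewrite (tnth_nth 0).
have S0 : 0 <= \sum_(i < N) h`_i by exact: stepsum_ge0.
have tau2 : 0 < L * (D / (2 * (\sum_(i < N) h`_i) + 1)) ^+ 2.
  by rewrite mulr_gt0// exprn_gt0// divr_gt0//; lra.
have phi_ge s : simplex s -> (rate%:E <= phi s)%E.
  move=> sS; apply: le_trans (worst_case_average_ge hd hpos hL hD sS).
  rewrite /rate sumE lee_fin lerDl (mulr_ge0 (ltW tau2))//.
  exact: average_gap_ge0.
split.
  apply/eqP; rewrite eq_le; apply/andP; split.
    by rewrite -phie; apply: ereal_inf_lbound; exists e.
  by apply: le_ereal_inf_tmp => _ [s /phi_ge ? <-].
apply/seteqP; split=> [s [sS smin]|_ ->]; last first.
  by split=> // t /phi_ge; rewrite -phie.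
apply: (average_gap_eq0 hpos sS).
(* Comparing a minimizer [s] with [e] bounds rate + L tau^2 gap by the rate; as L tau^2 > 0, the gap
   is at most 0. *)
apply/le_anti/andP; split; last exact: average_gap_ge0.
have := le_trans (worst_case_average_ge hd hpos hL hD sS) (smin e eS).
by rewrite phie /rate sumE lee_fin gerDl pmulr_rle0.
Qed.
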